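(* Let $q\ge3$, let $g\in\mathbb{F}_q[t]$ be a non-constant square-free polynomial that is not a Carmichael polynomial, and let $\ell$ be a prime factor of $q-1$. Then there exist infinitely many cyclic extensions $K$ of $\mathbb{F}_q(t)$ of degree $\ell$ whose discriminants are relatively prime to $g$ such that $g$ is not Carmichael in $K$.
   Context: $\mathbb{F}_q$ is the finite field with $q$ elements. A finite ring $S$ is a Carmichael ring if $S$ is not a field and $a^{|S|}=a$ for every $a\in S$; an ideal $I$ of a ring $R$ is a Carmichael ideal if $R/I$ is a Carmichael ring. A polynomial $g\in\mathbb{F}_q[t]$ is a Carmichael polynomial if $(g)$ is a Carmichael ideal of $\mathbb{F}_q[t]$. For a finite extension $K$ of $\mathbb{F}_q(t)$, $\mathcal{O}_K$ denotes the integral closure of $\mathbb{F}_q[t]$ in $K$, and an element $\alpha\in\mathcal{O}_K$ is Carmichael in $K$ if $\alpha\mathcal{O}_K$ is a Carmichael ideal of $\mathcal{O}_K$. The discriminant of $K$ is the discriminant ideal of $\mathcal{O}_K$ over $\mathbb{F}_q[t]$; ''relatively prime to $g$'' means no irreducible factor of $g$ divides it. *)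

(* Defs.v *)
From HB Require Import structures.
From mathcomp Require Import all_boot all_order all_algebra all_fingroup all_solvable all_field.
Set Implicit Arguments. Unset Strict Implicit. Unset Printing Implicit Defensive.
Import GRing.Theory.
Local Open Scope ring_scope.

(* O : R -> Prop is a subring of the commutative ring R (e.g. all of R, or an
   integral closure); a : R is an element of O.  The ring under study is
   S = O / aO. *)
Section Carmichael.
Variable R : comNzRingType.
Variables (O : R -> Prop) (a : R).

Definition qcong (x y : R) : Prop := exists z, O z /\ x - y = a * z.

Definition quot_card (N : nat) : Prop :=
  exists s : seq R,
    [/\ size s = N, (forall x, x \in s -> O x),
        (forall i j, (i < N)%N -> (j < N)%N -> qcong (nth 0 s i) (nth 0 s j) -> i = j)
      & (forall x, O x -> exists2 y, y \in s & qcong x y)].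

Definition quot_is_field : Prop :=
  ~ qcong 1 0 /\ (forall x, O x -> ~ qcong x 0 -> exists y, O y /\ qcong (x * y) 1).

Definition carmichael_ideal : Prop :=
  exists N : nat, [/\ quot_card N, ~ quot_is_field &
                      forall x, O x -> qcong (x ^+ N) x].
End Carmichael.

Section FunctionFields.
Variable F : finFieldType.

Definition Fqt := {fraction {poly F}}.

Definition embedK (L : splittingFieldType Fqt) (c : {poly F}) : L :=
  (tofrac c : Fqt)%:A.

Definition intclos (L : splittingFieldType Fqt) (x : L) : Prop :=
  exists p : {poly {poly F}}, p \is monic /\ root (map_poly (@embedK L) p) x.

Definition carmichael_poly (g : {poly F}) : Prop :=
  carmichael_ideal (fun _ : {poly F} => True) g.

Definition carmichael_in (L : splittingFieldType Fqt) (alpha : L) : Prop :=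
  carmichael_ideal (@intclos L) alpha.

Definition squarefree_poly (g : {poly F}) : Prop :=
  forall p : {poly F}, (1 < size p)%N -> ~~ (p * p %| g).

Definition tuple_disc (L : splittingFieldType Fqt)
    (x : 'I_(\dim {:L}) -> L) : L :=
  \det (\matrix_(i, j) galTrace 1%VS fullv (x i * x j)).

Definition disc_gen (L : splittingFieldType Fqt) (d : {poly F}) : Prop :=
  exists x : 'I_(\dim {:L}) -> L,
    (forall i, intclos (x i)) /\ embedK L d = tuple_disc x.

Definition disc_ideal (L : splittingFieldType Fqt) (d : {poly F}) : Prop :=
  exists (n : nat) (gen c : 'I_n -> {poly F}),
    (forall i, disc_gen L (gen i)) /\ d = \sum_(i < n) c i * gen i.

(* the discriminant of L is relatively prime to g: no irreducible factor of
   g divides (i.e. contains) it *)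
Definition disc_coprime (L : splittingFieldType Fqt) (g : {poly F}) : Prop :=
  forall p : {poly F}, irreducible_poly p -> p %| g ->
    ~ (forall d, disc_ideal L d -> p %| d).

Definition cyclic_ext (L : splittingFieldType Fqt) (l : nat) : Prop :=
  [/\ \dim {:L} = l, galois (1%VS : {vspace L}) fullv & cyclic 'Gal((fullv : {vspace L}) / 1%VS)%g].

Definition ext_iso (L1 L2 : splittingFieldType Fqt) : Prop :=
  exists f : L1 -> L2,
    [/\ {morph f : x y / x + y}, {morph f : x y / x * y}, f 1 = 1,
        (forall c : Fqt, f (c%:A) = c%:A) & bijective f].
End FunctionFields.

(* Main.v *)
Require Import Defs.
From HB Require Import structures.
From mathcomp Require Import all_boot all_order all_algebra all_fingroup all_solvable all_field.
From mathcomp Require Import boolp ring.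
Set Implicit Arguments. Unset Strict Implicit. Unset Printing Implicit Defensive.
Import GRing.Theory.
Local Open Scope ring_scope.

(** The extensions are Kummer extensions [K = F_q(t)(y)], [y^l = D].

    Write [n = deg g]. For squarefree [g], Carmichael means reducible with all
    degrees of irreducible factors dividing [n], so some irreducible factor [p]
    of [g] either is [g] up to a constant, or has degree [d] not dividing [n].
    Choose [D] prime to [g] with [D^((Q-1)/l) = z <> 1] modulo [p], where
    [Q = q^d] and [z] is an l-th root of unity in [F_q]. The traces
    [Tr (x y^(l-i))] show [D O_K] to lie in [F_q[t][y]], so away from [D] the
    ring [O_K] is [F_q[t][y]]: the discriminant is prime to [g], [|O_K/g|] is
    [q^(l n)], and [x^Q = s x] modulo [p], where [s] generates the Galois group
    and [s y = z y]. The last congruence forces [O_K/p] to be a field (a norm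
    divisible by [p] is a power of [x] modulo [p], and [s^l = 1]), which settles
    the first case. In the second case, if [x^(q^(l n)) = x] modulo [g] for all
    [x], then [d] divides [l n], say [l n = d m]; applied to [y] this gives
    [z^m = 1], so [l] divides [m] and [d] divides [n], a contradiction.

    To get infinitely many [K], let [D] be divisible exactly once by an
    irreducible [r] not dividing the previous radicands: by Kummer theory an
    isomorphism makes [D] an l-th power times a power of another radicand. *)

(** * Polynomials over a field: irreducible factors, coprime moduli, square-freeness *)

Lemma irreducible_factor (k : fieldType) (h : {poly k}) : (1 < size h)%N ->
  exists p : {poly k}, [/\ irreducible_poly p, p \is monic & p %| h].
Proof.
elim: {h}_.+1 {-2}h (ltnSn (size h)) => // n IHn h lehn h1.
have h0 : h != 0 by rewrite -size_poly_eq0; case: size h1.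
have [irrh|nirrh] := pselect (irreducible_poly h).
  have c0 : (lead_coef h)^-1 != 0 by rewrite invr_eq0 lead_coef_eq0.
  have hh : (lead_coef h)^-1 *: h %= h by apply: eqp_scale.
  exists ((lead_coef h)^-1 *: h); split.
  - split=> [|q q1]; first by rewrite size_scale.
    by rewrite (eqp_dvdr _ hh) => /(apply_irredp irrh q1) /eqp_trans -> //; rewrite eqp_sym.
  - by rewrite monicE lead_coefZ mulVf ?lead_coef_eq0.
  - by rewrite (eqp_dvdl _ hh).
have [d d1 [dh ndh]] : exists2 d : {poly k}, size d != 1 & d %| h /\ ~~ (d %= h).
  apply: contrapT => H; apply: nirrh; split=> // d d1 dh.
  by apply: contraT => ndh; case: H; exists d.
have d0 : d != 0 by apply: contraNneq h0 => d0; rewrite -dvd0p -d0.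
have ltdh : (size d < size h)%N.
  by rewrite ltn_neqAle dvdp_leq // andbT; apply: contraNneq ndh => /eqP; rewrite dvdp_size_eqp.
have [||p [ip mp pd]] := IHn d.
- exact: leq_trans ltdh lehn.
- by rewrite ltn_neqAle eq_sym d1 size_poly_gt0.
by exists p; split=> //; apply: dvdp_trans dh.
Qed.

Lemma irreducible_dvdpM (k : fieldType) (p a b : {poly k}) :
  irreducible_poly p -> (p %| a * b) = (p %| a) || (p %| b).
Proof.
move=> ip; apply/idP/orP => [pab|[]]; [|exact: dvdp_mulr|exact: dvdp_mull].
have [|npa] := boolP (p %| a); [by left|right].
by rewrite -(Gauss_dvdpr b (_ : coprimep p a)) ?irreducible_poly_coprime.
Qed.

Lemma irreducible_dvdpX (k : fieldType) (p a : {poly k}) n :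
  irreducible_poly p -> p %| a ^+ n -> p %| a.
Proof.
move=> ip; elim: n => [|n IHn]; last by rewrite exprS irreducible_dvdpM // => /orP[].
by rewrite expr0 dvdp1 => /eqP p1; case: ip; rewrite p1.
Qed.

Lemma polynomial_crt (k : fieldType) (a b u v : {poly k}) : coprimep a b ->
  exists x, a %| x - u /\ b %| x - v.
Proof.
case/Bezout_eq1_coprimepP=> -[s t] /= st.
have tb : t * b = 1 - s * a by rewrite -st addrC addKr.
exists (u * (t * b) + v * (s * a)); split.
  by rewrite tb (_ : _ - u = (v * s - u * s) * a) ?dvdp_mull //; ring.
have sa : s * a = 1 - t * b by rewrite -st addrK.
by rewrite sa (_ : _ - v = (u * t - v * t) * b) ?dvdp_mull //; ring.
Qed.

(** Write [g = w * gcdp g h]. An irreducible factor [p] of [w] divides [g], hence [h], hence also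
    the gcd, so [p * p] would divide [g]. Thus [w] is constant. *)
Lemma squarefree_dvdp (F : finFieldType) (g h : {poly F}) : g != 0 -> squarefree_poly g ->
  (forall p, irreducible_poly p -> p %| g -> p %| h) -> g %| h.
Proof.
move=> g0 sqg gh; have /dvdpP[w gw] := dvdp_gcdl g h.
have w0 : w != 0 by apply: contraNneq g0 => w0; rewrite gw w0 mul0r.
have [w1|] := leqP (size w) 1%N.
  have /size_poly1P[c c0 wc] : size w == 1 by rewrite eqn_leq w1 size_poly_gt0.
  by rewrite gw wc mul_polyC dvdpZl // dvdp_gcdr.
case/irreducible_factor => p [ip _ pw].
have pg : p %| g by rewrite gw dvdp_mulr.
have /negP[] := sqg p ip.1.
by rewrite gw dvdp_mul // dvdp_gcd pg gh.
Qed.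

(** * The ring [F_q[t]] is integrally closed in [F_q(t)] *)

Section Fractions.
Import generic_quotient.
Local Open Scope quotient_scope.

Lemma fracE (R : idomainType) (u : {fraction R}) :
  exists a b : R, b != 0 /\ u = FracField.tofrac a / FracField.tofrac b.
Proof.
elim/quotW: u => x; exists (frac x).1, (frac x).2.
have x0 := denom_ratioP x; split=> //.
suff E : \pi_{fraction R} x * FracField.tofrac (frac x).2 = FracField.tofrac (frac x).1.
  by rewrite -E mulfK // tofrac_eq0.
rewrite [in LHS]/GRing.mul /= !piE; apply/eqmodP.
rewrite /= FracField.equivfE /FracField.mulf.
by rewrite !numden_Ratio ?oner_eq0 ?mulf_neq0 ?oner_eq0 //= !mulr1 mulrC.
Qed.

End Fractions.

(** This is the rational root argument: for [u = a / b] in lowest terms, clearing denominators in a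
    monic equation of degree [n] gives [b %| a ^+ n], so [b] is constant. *)
Lemma integral_Fqt (F : finFieldType) (u : Fqt F) :
  integralOver (@FracField.tofrac {poly F}) u -> exists a, u = FracField.tofrac a.
Proof.
have [a' [b' [b'0 ->]]] := fracE u; set g := gcdp a' b'.
have g0 : g != 0 by rewrite gcdp_eq0 (negPf b'0) andbF.
have [a aE] : exists a, a' = a * g by apply/dvdpP/dvdp_gcdl.
have [b bE] : exists b, b' = b * g by apply/dvdpP/dvdp_gcdr.
have b0 : b != 0 by apply: contraNneq b'0 => b0; rewrite bE b0 mul0r.
have cab : coprimep a b.
  have : coprimep (a' %/ g) (b' %/ g) by apply: coprimep_div_gcd; rewrite b'0 orbT.
  by rewrite {1}aE {1}bE !mulpK.
rewrite {1 2}aE {1 2}bE !tofracM invfM mulrACA divff ?tofrac_eq0 // mulr1.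
case=> P mP /rootP.
set n := (size P).-1; have sP : size P = n.+1.
  by rewrite prednK // size_poly_gt0 monic_neq0.
have bf0 : FracField.tofrac b != 0 by rewrite tofrac_eq0.
rewrite -[map_poly _ _]coefK size_map_poly_id0 ?(monicP mP) ?tofrac1 ?oner_eq0 // sP.
rewrite poly_def horner_sum big_ord_recr /=.
have Pn : P`_n = 1 by apply/eqP.
rewrite !hornerE coef_map /= Pn tofrac1 mul1r => PE.
have an : a ^+ n = - \sum_(i < n) P`_i * a ^+ i * b ^+ (n - i).
  apply/eqP; rewrite -addr_eq0 -tofrac_eq0; apply/eqP.
  rewrite -[RHS](mul0r (FracField.tofrac b ^+ n)) -PE mulrDl -exprMn mulfVK // mulr_suml.
  rewrite tofracD tofracXn addrC; congr (_ + _); rewrite raddf_sum; apply: eq_bigr => i _ /=.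
  rewrite !hornerE coef_map /= !tofracM !tofracXn exprMn exprVn.
  have -> : FracField.tofrac b ^+ n = FracField.tofrac b ^+ (n - i) * FracField.tofrac b ^+ i.
    by rewrite -exprD subnK // ltnW.
  rewrite -!mulrA; congr (_ * (_ * _)).
  by rewrite mulrCA mulVf ?expf_neq0 // mulr1.
have ban : b %| a ^+ n.
  rewrite an dvdpNr; apply: (big_ind (fun x => b %| x)); [exact: dvdp0|exact: dvdp_add|].
  by move=> i _; apply/dvdp_mull/dvdp_exp; rewrite ?subn_gt0.
have /size_poly1P[c c0 bc] : size b == 1.
  rewrite -dvdp1 -(@Gauss_dvdpr _ _ (a ^+ n)) ?mulr1 //.
  by rewrite coprimep_sym coprimep_expl.
exists (c^-1 *: a); apply: (mulIf bf0); rewrite mulfVK // -tofracM bc mulrC mul_polyC scalerA.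
by rewrite mulfV // scale1r.
Qed.

(** * Residue fields of [F_q[t]], their Frobenius and power residues *)

Lemma dvdn_predX l q d : (l %| q.-1)%N -> (l %| (q ^ d).-1)%N.
Proof.
move/dvdn_trans; apply.
by rewrite -!subn1 -[X in (_ %| _ - X)%N](exp1n d) subn_exp dvdn_mulr.
Qed.

Section ResidueField.
Variables (F : finFieldType) (p : {poly F}).
Hypothesis ip : monic_irreducible_poly p.

(** Reduction modulo [p], typed with the quotient as a field so that it can carry a ring morphism
    structure into that field. *)
Definition residue (a : {poly F}) : {poly %/ p with ip} := in_qpoly p a.

Fact residue_is_zmod_morphism : zmod_morphism residue.
Proof. exact: (raddfB (in_qpoly p)). Qed.
Fact residue_is_monoid_morphism : monoid_morphism residue.
Proof. by split; [exact: in_qpoly1|exact: in_qpolyM]. Qed.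
HB.instance Definition _ := GRing.isZmodMorphism.Build _ _ residue residue_is_zmod_morphism.
HB.instance Definition _ := GRing.isMonoidMorphism.Build _ _ residue residue_is_monoid_morphism.

Lemma residue_eq0 a : (residue a == 0) = (p %| a).
Proof.
by apply/eqP/idP => [/val_eqP|pa]; [|apply/val_eqP];
  rewrite /= -Pdiv.IdomainMonic.modpE ?mk_monicE //; case: ip.
Qed.

Lemma residue_surj (x : {poly %/ p with ip}) : exists a, residue a = x.
Proof.
exists (val x); apply: val_inj; apply: in_qpoly_small; exact: size_mk_monic.
Qed.

Local Notation K := {poly %/ p with ip}.
Let q := #|F|.
Let d := (size p).-1.

Lemma dvdp_frobenius a : p %| a ^+ (q ^ d) - a.
Proof. by rewrite -residue_eq0 rmorphB rmorphXn /= -card_qfpoly expf_card subrr. Qed.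

Lemma dvdp_frobenius_exp n a : (d %| n)%N -> p %| a ^+ (q ^ n) - a.
Proof.
case/dvdnP=> j ->; rewrite -residue_eq0 rmorphB rmorphXn /= subr_eq0; apply/eqP.
elim: j => [|j IHj]; first by rewrite mul0n.
by rewrite mulSn expnD exprM -card_qfpoly expf_card.
Qed.

(** With [m = (q^d - 1) / l], the polynomial [X^m - 1] has at most [m] roots, fewer than the
    [q^d - 1] nonzero residues. *)
Lemma exists_power_nonresidue l : prime l -> (l %| q.-1)%N ->
  exists c, ~~ (p %| c) && ~~ (p %| c ^+ ((q ^ d).-1 %/ l) - 1).
Proof.
move=> pl lq; set m := (_ %/ l)%N.
have cK : #|K| = (q ^ d)%N by apply: card_qfpoly.
have K1 : (1 < q ^ d)%N by rewrite -cK card_qfpoly_gt1.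
have lQ := dvdn_predX d lq.
have m0 : (0 < m)%N by rewrite divn_gt0 ?prime_gt0 // dvdn_leq // -subn1 subn_gt0.
have ltm : (m < (q ^ d).-1)%N by rewrite ltn_Pdiv ?prime_gt1 // -subn1 subn_gt0.
have [x /andP[x0 xm]] : exists x : K, (x != 0) && (x ^+ m != 1).
  apply/existsP; apply: contraT; rewrite negb_exists => /forallP H.
  have P0 : ('X^m - 1 : {poly K}) != 0 by rewrite -size_poly_eq0 size_XnsubC.
  have := max_poly_roots P0 (_ : all (root _) (enum (predC1 (0 : K)))) (enum_uniq _).
  rewrite size_XnsubC // -cardE cardC1 cK ltnS leqNgt ltm; apply.
  apply/allP => x; rewrite mem_enum inE => x0; have := H x.
  by rewrite x0 negbK rootE !hornerE subr_eq0.
have [c cx] := residue_surj x; exists c.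
by rewrite -!residue_eq0 rmorphB rmorphXn rmorph1 /= cx x0 subr_eq0.
Qed.

(** The power of [D] is an [l]-th root of unity in the residue field, and the image of [z] is a
    primitive one there, so constants represent all of them. *)
Lemma power_residue_symbol l (z : F) D : l.-primitive_root z -> (l %| q.-1)%N -> ~~ (p %| D) ->
  exists i, p %| D ^+ ((q ^ d).-1 %/ l) - (z ^+ i)%:P.
Proof.
move=> pz lq pD; set m := (_ %/ l)%N.
pose rz := residue z%:P.
have prz : l.-primitive_root rz.
  by rewrite (fmorph_primitive_root (residue \o polyC)).
have lQ := dvdn_predX d lq.
have D1 : (residue D) ^+ m ^+ l = 1.
  rewrite -exprM divnK //; have D0 : residue D != 0 by rewrite residue_eq0.
  apply: (mulfI D0); rewrite -exprS prednK ?expn_gt0 ?(ltnW (card_finNzRing_gt1 F)) //.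
  by rewrite -card_qfpoly expf_card mulr1.
have [i Di] := prim_rootP prz D1; exists i.
by rewrite -residue_eq0 rmorphB rmorphXn /= Di /rz -rmorphXn -rmorphXn subrr.
Qed.

(** Let [r = m %% d]. As [x^(q^d) = x] on the residue field, the hypothesis becomes [x^(q^r) = x]
    for all [q^d] residues. If [0 < r < d], then [X^(q^r) - X] has too many roots. *)
Lemma frobenius_order m : (forall a, p %| a ^+ (q ^ m) - a) -> (d %| m)%N.
Proof.
move=> H.
have cK : #|K| = (q ^ d)%N by apply: card_qfpoly.
have q1 : (1 < q)%N by apply: card_finNzRing_gt1.
have fr (x : K) : x ^+ (q ^ m) = x.
  have [a <-] := residue_surj x.
  by apply/eqP; rewrite -subr_eq0 -rmorphXn -rmorphB residue_eq0.
have fd (x : K) j : x ^+ (q ^ (j * d)) = x.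
  elim: j => [|j IHj]; first by rewrite mul0n.
  by rewrite mulSn expnD exprM -cK expf_card.
have d0 : (0 < d)%N by rewrite /d -subn1 subn_gt0; case: ip => -[].
rewrite /dvdn; apply: contraT; rewrite -lt0n; set r := (m %% d)%N => r0.
have rd : (r < d)%N by rewrite ltn_mod.
have qr1 : (1 < q ^ r)%N by rewrite -(expn0 q) ltn_exp2l.
have P1 : size ('X^(q ^ r) - 'X : {poly K}) = (q ^ r).+1.
  by rewrite size_polyDl size_polyXn // size_polyN size_polyX.
have P0 : ('X^(q ^ r) - 'X : {poly K}) != 0 by rewrite -size_poly_eq0 P1.
have := max_poly_roots P0 (_ : all (root _) (enum K)) (enum_uniq _).
rewrite P1 -cardE cK ltnS leq_exp2l // leqNgt rd; apply.
apply/allP => x _; rewrite rootE !hornerE subr_eq0 -{2}(fr x).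
by rewrite (divn_eq m d) -/r expnD exprM fd.
Qed.
End ResidueField.

(** * Kummer theory over a field containing a primitive [l]-th root of unity *)

Lemma kummer_factorization (k : fieldType) l (z y : k) : l.-primitive_root z -> y != 0 ->
  'X^l - (y ^+ l)%:P = \prod_(x <- [seq z ^+ i * y | i <- iota 0 l]) ('X - x%:P)
  /\ uniq [seq z ^+ i * y | i <- iota 0 l].
Proof.
move=> pz y0; have l0 := prim_order_gt0 pz.
have U : uniq [seq z ^+ i * y | i <- iota 0 l].
  rewrite map_inj_in_uniq ?iota_uniq // => i j; rewrite !mem_iota !add0n => il jl.
  by move/(mulIf y0)/eqP; rewrite (eq_prim_root_expr pz) !modn_small // => /eqP.
split=> //; rewrite [LHS](@all_roots_prod_XsubC _ _ [seq z ^+ i * y | i <- iota 0 l]).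
- by rewrite lead_coefXnsubC // scale1r.
- by rewrite size_XnsubC // size_map size_iota.
- apply/allP => _ /mapP[i _ ->]; rewrite rootE !hornerE exprMn exprAC.
  by rewrite (prim_expr_order pz) expr1n mul1r subrr.
- by rewrite uniq_rootsE.
Qed.

(** A root [y] of some irreducible factor of [X^l - D] is adjoined. The other roots of [X^l - D] are
    the [z^i y], so the result is a splitting field. *)
Lemma exists_kummer_extension (k : fieldType) l (z D : k) : l.-primitive_root z -> D != 0 ->
  exists (L : splittingFieldType k) (y : L), y ^+ l = D%:A /\ <<1; y>>%VS = fullv.
Proof.
move=> pz D0; have l0 := prim_order_gt0 pz.
have [|p [ip _ pD]] := @irreducible_factor k ('X^l - D%:P); first by rewrite size_XnsubC.
have [L0 _ [y py yV]] := irredp_FAdjoin ip.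
have yl : y ^+ l = D%:A.
  have : root (map_poly (in_alg L0) ('X^l - D%:P)) y.
    by rewrite -dvdp_XsubCl; apply: dvdp_trans (_ : map_poly (in_alg L0) p %| _);
      rewrite ?dvdp_XsubCl ?dvdp_map.
  rewrite rootE => /eqP.
  by rewrite rmorphB /= map_polyXn map_polyC /= !hornerE => /eqP; rewrite subr_eq0 => /eqP.
have y0 : y != 0.
  apply: contraNneq D0 => y0; move: yl; rewrite y0 expr0n (gtn_eqF l0) => /esym/eqP.
  by rewrite scaler_eq0 oner_eq0 orbF.
have pzL : l.-primitive_root (z%:A : L0) by rewrite (fmorph_primitive_root (in_alg L0)).
have [fact _] := kummer_factorization pzL y0.
have spl : splitting_field_axiom L0.
  exists ('X^l - (y ^+ l)%:P).
    by rewrite yl rpredB ?rpredX ?polyOverX ?polyOverC ?rpredZ ?mem1v.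
  exists [seq z%:A ^+ i * y | i <- iota 0 l]; first by rewrite fact eqpxx.
  apply/eqP; rewrite eqEsubv subvf -yV -adjoin_seq1 adjoin_seqSr // => x.
  rewrite inE => /eqP ->; apply/mapP; exists 0; first by rewrite mem_iota.
  by rewrite expr0 mul1r.
pose L := HB.pack_for (splittingFieldType k) L0 (FieldExt_isSplittingField.Build k L0 spl).
by exists L, y.
Qed.

Section Kummer.
Variables (k : fieldType) (l : nat) (z D : k) (L : splittingFieldType k) (y : L).
Hypotheses (pl : prime l) (pz : l.-primitive_root z) (yl : y ^+ l = D%:A).
Hypotheses (yV : <<1; y>>%VS = fullv) (Dl : forall u, u ^+ l != D).

Lemma kummer_gen_neq0 : y != 0.
Proof.
apply: contraTneq (Dl 0) => y0; rewrite negbK.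
move: yl; rewrite y0 !expr0n (gtn_eqF (prime_gt0 pl)) => /esym/eqP.
by rewrite scaler_eq0 oner_eq0 orbF eq_sym.
Qed.
Let y0 := kummer_gen_neq0.

Let pzL : l.-primitive_root (z%:A : L).
Proof. by rewrite (fmorph_primitive_root (in_alg L)). Qed.

Let polyOver_XnsubC : 'X^l - (y ^+ l)%:P \is a polyOver 1%VS.
Proof. by rewrite yl rpredB ?rpredX ?polyOverX ?polyOverC ?rpredZ ?mem1v. Qed.

Lemma kummer_galois : galois (1%VS : {vspace L}) fullv.
Proof.
have [fact U] := kummer_factorization pzL y0.
set rs := [seq _ | i <- iota 0 l] in fact U.
have V : (fullv <= <<1 & rs>>)%VS.
  rewrite -yV -adjoin_seq1 adjoin_seqSr // => x.
  rewrite inE => /eqP ->; apply/mapP; exists 0; first by rewrite mem_iota prime_gt0.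
  by rewrite expr0 mul1r.
apply/(@splitting_galoisField _ _ 1%AS {:L}%AS); exists ('X^l - (y ^+ l)%:P); split=> //.
  by rewrite fact separable_prod_XsubC.
exists rs; first by rewrite fact eqpxx.
by apply/eqP; rewrite eqEsubv subvf V.
Qed.

(** Stated for any [w] with [w^l] in the base field, since it serves both for [y] and for the image
    of a root of another radicand. *)
Lemma gal_root_scale (s : gal_of {:L}) (w : L) c : w != 0 -> w ^+ l = c%:A ->
  exists i, s w = z%:A ^+ i * w.
Proof.
move=> w0 wl; have E : (s w / w) ^+ l = 1.
  rewrite exprMn exprVn -rmorphXn /= wl linearZ /= rmorph1 divff //.
  by rewrite -wl expf_neq0.
by have [i swi] := prim_rootP pzL E; exists i; rewrite -swi mulfVK.
Qed.

Lemma mem_baseP (x : L) : (forall s, s \in 'Gal({:L} / 1)%g -> s x = x) -> exists c, x = c%:A.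
Proof.
move=> H; have /galois_fixedField E := kummer_galois.
have : x \in fixedField 'Gal({:L} / 1)%g by apply/fixedFieldP; rewrite ?memvf.
by rewrite E => /vlineP[c ->]; exists c.
Qed.

Lemma kummer_dim_leq : (\dim {:L} <= l)%N.
Proof.
have -> : \dim {:L} = adjoin_degree 1 y by rewrite -yV dim_Fadjoin dimv1 muln1.
have l0 := prime_gt0 pl.
have : minPoly 1 y %| 'X^l - (y ^+ l)%:P.
  by apply: minPoly_dvdp; rewrite // rootE !hornerE subrr.
by move/dvdp_leq; rewrite -size_poly_gt0 size_XnsubC // size_minPoly ltnS; apply.
Qed.

Lemma gal_exp_root (s : gal_of {:L}) i n : s y = z%:A ^+ i * y ->
  (s ^+ n)%g y = z%:A ^+ (i * n) * y.
Proof.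
move=> sy; elim: n => [|n IHn]; first by rewrite expg0 gal_id muln0 expr0 mul1r.
rewrite expgSr galM ?memvf // IHn rmorphM rmorphXn /= linearZ /= rmorph1 sy.
by rewrite mulrA -exprD mulnS addnC.
Qed.

(** Since [y] is not in the base field, some [t] moves it, and a suitable power [s] of [t]
    multiplies it by [z]. The order of [s] is then at least [l], while the degree is at most [l], so
    both equal [l] and [s] generates. *)
Lemma kummer_generator : exists s : gal_of {:L},
  [/\ s y = z%:A * y, 'Gal({:L} / 1)%g = <[s]>%g & \dim {:L} = l].
Proof.
have [t tG ty] : exists2 t, t \in 'Gal({:L} / 1)%g & t y != y.
  apply: contrapT => H; have [|c yc] := @mem_baseP y.
    by move=> s sG; apply: contrapT => /eqP sy; case: H; exists s.
  have /eqP[] := Dl c; apply: (fmorph_inj (in_alg L)).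
  by rewrite rmorphXn /= -yc yl.
have [i tyi] := gal_root_scale t y0 yl.
have il : coprime i l.
  rewrite coprime_sym prime_coprime //; apply: contra ty => /dvdnP[j ij].
  by rewrite tyi ij mulnC exprM (prim_expr_order pzL) expr1n mul1r.
(* This [j] is the inverse of [i] modulo [l], so [t^j] multiplies [y] by [z^(i j) = z]. *)
have [j ij] : exists j, (i * j == 1 %[mod l])%N.
  have i0 : (0 < i)%N by case: i il {tyi} => //; rewrite /coprime gcd0n => /eqP l1; have := pl; rewrite l1.
  have [u v E _] := egcdnP l i0; exists u.
  by rewrite mulnC E (eqP il) modnMDl.
pose s := (t ^+ j)%g; have sy : s y = z%:A ^+ 1 * y.
  by rewrite (gal_exp_root _ tyi); congr (_ * _); apply/eqP; rewrite (eq_prim_root_expr pzL).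
have lo : (l %| #[s]%g)%N.
  have := gal_exp_root #[s]%g sy; rewrite expg_order gal_id mul1n -{1}[y]mul1r.
  by move/(mulIf y0)/esym/eqP; rewrite -(prim_order_dvd pzL).
have sG : <[s]>%g \subset 'Gal({:L} / 1)%g by rewrite cycle_subG groupX.
have cG : \dim {:L} = #|'Gal({:L} / 1)%g|.
  by rewrite -(galois_dim kummer_galois) dimv1 divn1.
have lel : (l <= #|<[s]>%g|)%N by rewrite dvdn_leq // order_gt0.
exists s; split; first by rewrite sy expr1.
  apply/esym/eqP; rewrite eqEcard sG -cG; exact: leq_trans kummer_dim_leq lel.
apply/eqP; rewrite eqn_leq kummer_dim_leq cG.
exact: leq_trans lel (subset_leq_card sG).
Qed.

End Kummer.

(** * Congruences and cardinality of a quotient ring *)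

Section Quotient.
Variables (R : comNzRingType) (O : R -> Prop) (a : R).
Hypothesis OB : forall x y, O x -> O y -> O (x - y).

Lemma qcong_sym x y : qcong O a x y -> qcong O a y x.
Proof.
case=> w [Ow E]; have O0 : O 0 by rewrite -(subrr w); apply: OB.
by exists (- w); split; [rewrite -sub0r; apply: OB|rewrite mulrN -E opprB].
Qed.

Lemma qcong_trans x y t : qcong O a x y -> qcong O a y t -> qcong O a x t.
Proof.
case=> w [Ow E] /qcong_sym[v [Ov E']]; exists (w - v); split; first exact: OB.
by rewrite mulrBr -E -E' opprB addrA subrK.
Qed.

Lemma quot_card_leq N M : quot_card O a N -> quot_card O a M -> (N <= M)%N.
Proof.
case=> s [sN sO sI _] [t [tM _ _ tS]].
have /choice[f fP] (i : 'I_N) : exists j : 'I_M, qcong O a s`_i t`_j.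
  have [|y yt cy] := tS s`_i; first by apply/sO/mem_nth; rewrite sN.
  have yM : (index y t < M)%N by rewrite -tM index_mem.
  by exists (Ordinal yM); rewrite /= nth_index.
rewrite -(card_ord N) -(card_ord M); apply: (@leq_card _ _ f) => i j fij.
apply/val_inj/sI => //=; apply: qcong_trans (fP i) _; rewrite fij; exact/qcong_sym/fP.
Qed.

(** Since [quot_card] is a relation, this is what identifies the exponent in [carmichael_ideal] once
    the quotient has been counted. *)
Lemma quot_card_unique N M : quot_card O a N -> quot_card O a M -> N = M.
Proof. by move=> HN HM; apply/eqP; rewrite eqn_leq !quot_card_leq. Qed.

Lemma quot_card_reps (T : finType) (rep : T -> R) :
  (forall t, O (rep t)) -> (forall t u, qcong O a (rep t) (rep u) -> t = u) ->
  (forall x, O x -> exists t, qcong O a x (rep t)) -> quot_card O a #|T|.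
Proof.
move=> repO repI repS; have sz : size [seq rep t | t <- enum T] = #|T| by rewrite size_map -cardE.
exists [seq rep t | t <- enum T]; split=> //.
- by move=> x /mapP[t _ ->].
- move=> i j iT jT; have [t0 _] : exists t0 : T, t0 \in T.
    by apply/card_gt0P; apply: leq_ltn_trans iT.
  have ie : (i < size (enum T))%N by rewrite -cardE.
  have je : (j < size (enum T))%N by rewrite -cardE.
  rewrite (nth_map t0 0 _ ie) (nth_map t0 0 _ je) => /repI /eqP.
  by rewrite nth_uniq ?enum_uniq // => /eqP.
- by move=> x /repS[t xt]; exists (rep t); rewrite // map_f // mem_enum.
Qed.

End Quotient.

(** * The integral closure of [F_q[t]] and congruences in it *)

Section IntegralClosure.
Variables (F : finFieldType) (L : splittingFieldType (Fqt F)).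
Local Notation O := (@intclos F L).
Local Notation e := (embedK L).

HB.instance Definition _ := GRing.RMorphism.copy (embedK L) (in_alg L \o @FracField.tofrac {poly F}).

Lemma embedK_eq0 a : (e a == 0) = (a == 0).
Proof. by rewrite scaler_eq0 oner_eq0 orbF tofrac_eq0. Qed.

Lemma embedK_inj : injective e.
Proof. by move=> a b /eqP; rewrite -subr_eq0 -rmorphB embedK_eq0 subr_eq0 => /eqP. Qed.

Lemma intclosP x : O x <-> integralOver e x.
Proof. by split=> [[p []]|[p]]; exists p. Qed.

Lemma intclos_embedK a : O (e a).
Proof. exact/intclosP/integral_id. Qed.

Lemma intclosD x w : O x -> O w -> O (x + w).
Proof. by move=> /intclosP ? /intclosP ?; apply/intclosP/integral_add. Qed.

Lemma intclosB x w : O x -> O w -> O (x - w).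
Proof. by move=> /intclosP ? /intclosP ?; apply/intclosP/integral_sub. Qed.

Lemma intclosM x w : O x -> O w -> O (x * w).
Proof. by move=> /intclosP ? /intclosP ?; apply/intclosP/integral_mul. Qed.

Lemma intclos0 : O 0. Proof. by rewrite -(rmorph0 e); apply: intclos_embedK. Qed.
Lemma intclos1 : O 1. Proof. by rewrite -(rmorph1 e); apply: intclos_embedK. Qed.

Lemma intclosX x n : O x -> O (x ^+ n).
Proof.
by move=> Ox; elim: n => [|n IHn]; [exact: intclos1|rewrite exprS; apply: intclosM].
Qed.

Lemma intclos_sum (I : Type) (r : seq I) (P : pred I) (E : I -> L) :
  (forall i, P i -> O (E i)) -> O (\sum_(i <- r | P i) E i).
Proof. by move=> OE; apply: big_ind => //; [exact: intclos0|exact: intclosD]. Qed.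

Lemma intclos_prod (I : Type) (r : seq I) (P : pred I) (E : I -> L) :
  (forall i, P i -> O (E i)) -> O (\prod_(i <- r | P i) E i).
Proof. by move=> OE; apply: big_ind => //; [exact: intclos1|exact: intclosM]. Qed.

Lemma gal_in_alg (s : gal_of {:L}) c : s c%:A = c%:A.
Proof. by rewrite linearZ /= rmorph1. Qed.

Lemma gal_embedK (s : gal_of {:L}) a : s (e a) = e a.
Proof. exact: gal_in_alg. Qed.

Lemma intclos_gal (s : gal_of {:L}) x : O x -> O (s x).
Proof.
case=> p [mp px]; exists p; split=> //.
have -> : map_poly e p = map_poly s (map_poly e p).
  by rewrite -map_poly_comp; apply: eq_map_poly => a /=; rewrite gal_embedK.
by rewrite fmorph_root.
Qed.

Lemma intclos_base c : O c%:A -> exists a, c%:A = e a.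
Proof.
case=> p [mp]; rewrite (_ : map_poly e p = map_poly (in_alg L) (map_poly (@FracField.tofrac _) p)).
  rewrite fmorph_root => pc.
  by have [|a ->] := @integral_Fqt F c; [exists p|exists a].
by rewrite -map_poly_comp.
Qed.

Lemma qcong0 a x w : O w -> x = a * w -> qcong O a x 0.
Proof. by move=> Ow ->; exists w; rewrite subr0. Qed.

Lemma qcong_refl a x : qcong O a x x.
Proof. by exists 0; rewrite mulr0 subrr; split; first exact: intclos0. Qed.

Lemma qcongD a x x' w w' :
  qcong O a x x' -> qcong O a w w' -> qcong O a (x + w) (x' + w').
Proof.
case=> u [Ou xu] [v [Ov wv]]; exists (u + v); split; first exact: intclosD.
by rewrite mulrDr -xu -wv addrACA opprD.
Qed.

Lemma qcongM a x x' w w' : O x -> O w' ->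
  qcong O a x x' -> qcong O a w w' -> qcong O a (x * w) (x' * w').
Proof.
move=> Ox Ow' [u [Ou xu]] [v [Ov wv]]; exists (x * v + u * w'); split.
  by apply: intclosD; apply: intclosM.
by rewrite mulrDr [a * (x * v)]mulrCA -wv [a * (u * w')]mulrA -xu mulrBr mulrBl addrA subrK.
Qed.

Lemma qcongX a x x' n : O x -> O x' -> qcong O a x x' -> qcong O a (x ^+ n) (x' ^+ n).
Proof.
move=> Ox Ox' xx'; elim: n => [|n IHn]; first exact: qcong_refl.
by rewrite !exprS; apply: qcongM => //; apply: intclosX.
Qed.

Lemma qcong_dvdp p g x w : p %| g -> qcong O (e g) x w -> qcong O (e p) x w.
Proof.
case/dvdpP=> h -> [u [Ou E]]; exists (e h * u); split.
  by apply: intclosM => //; apply: intclos_embedK.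
by rewrite E rmorphM /= mulrCA mulrA.
Qed.

(** If [a - b = p w] with [w] integral, then [w] is the fraction [(a - b) / p], and an integral
    element of [F_q(t)] is a polynomial. *)
Lemma qcong_embedK p a b : p != 0 -> qcong O (e p) (e a) (e b) <-> p %| a - b.
Proof.
move=> p0; split=> [[w [Ow E]]|/dvdpP[h abh]]; last first.
  by exists (e h); rewrite -rmorphM -rmorphB abh mulrC; split; first exact: intclos_embedK.
have wE : w = (FracField.tofrac (a - b) / FracField.tofrac p)%:A.
  have ep0 : e p != 0 by rewrite embedK_eq0.
  apply: (mulfI ep0); rewrite -E -rmorphB /= -[RHS](rmorphM (in_alg L)).
  by rewrite mulrC mulfVK ?tofrac_eq0.
have [|h hE] := @intclos_base (FracField.tofrac (a - b) / FracField.tofrac p).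
  by rewrite -wE.
by apply/dvdpP; exists h; apply: (@embedK_inj); rewrite rmorphB E wE hE rmorphM mulrC.
Qed.

End IntegralClosure.

(** * Kummer extensions of [F_q(t)]: traces, discriminant, residue rings *)

Lemma pchar_nat_card (F : finFieldType) (R : nzRingType) (f : {rmorphism F -> R}) :
  [pchar R].-nat #|F|.
Proof.
have [c pc cF] := finPcharP F; rewrite (eq_pnat _ (fmorph_pchar f)).
by rewrite [#|F|](card_pprimeChar cF) pnatX pnatE // cF.
Qed.

Lemma primitive_root_Fqt (F : finFieldType) l (z : F) : l.-primitive_root z ->
  l.-primitive_root (FracField.tofrac z%:P : Fqt F).
Proof. by rewrite (fmorph_primitive_root (@FracField.tofrac {poly F} \o polyC)). Qed.

Lemma no_power_Fqt (F : finFieldType) l (D : {poly F}) : (0 < l)%N ->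
  (forall a : {poly F}, a ^+ l != D) -> forall u : Fqt F, u ^+ l != FracField.tofrac D.
Proof.
move=> l0 Dl u; apply/eqP => uD; have [|a ua] := @integral_Fqt F u.
  exists ('X^l - D%:P); first exact: monicXnsubC.
  by rewrite rmorphB /= map_polyXn map_polyC rootE !hornerE uD subrr.
by have /eqP[] := Dl a; apply/eqP; rewrite -tofrac_eq tofracXn -ua uD.
Qed.

Section KummerFunctionField.
Variables (F : finFieldType) (l : nat) (z : F) (D : {poly F}).
Variables (L : splittingFieldType (Fqt F)) (y : L).
Hypotheses (pl : prime l) (pz : l.-primitive_root z) (yl : y ^+ l = embedK L D).
Hypotheses (yV : <<1; y>>%VS = fullv) (Dl : forall a : {poly F}, a ^+ l != D).
Local Notation O := (@intclos F L).
Local Notation e := (embedK L).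
Local Notation Tr := (galTrace 1%VS (fullv : {vspace L})).

Let l0 := prime_gt0 pl.
Let pzk := primitive_root_Fqt pz.
Let Dk := no_power_Fqt l0 Dl.
Let y0 : y != 0 := kummer_gen_neq0 pl yl Dk.
Let galL : galois (1%VS : {vspace L}) fullv := kummer_galois pl pzk yl yV Dk.

Lemma intclos_root : O y.
Proof.
exists ('X^l - D%:P); split; first exact: monicXnsubC.
by rewrite rmorphB /= map_polyXn map_polyC rootE !hornerE yl subrr.
Qed.

Lemma natl_neq0 : l%:R != 0 :> F.
Proof. exact: prim_root_natf_neq0 pz. Qed.

Lemma kummer_generator_Fqt : exists s : gal_of {:L},
  [/\ s y = e z%:P * y, 'Gal({:L} / 1)%g = <[s]>%g & \dim {:L} = l].
Proof. exact: kummer_generator pl pzk yl yV Dk. Qed.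

Lemma exprz_eq1 k : (e z%:P ^+ k == 1) = (l %| k)%N.
Proof.
rewrite -!rmorphXn -(rmorph1 e) (inj_eq (@embedK_inj _ _)) -polyC1 (inj_eq (@polyC_inj _)).
by rewrite (prim_order_dvd pz).
Qed.

Lemma galTrace_scale c x : Tr (c%:A * x) = c%:A * Tr x.
Proof.
by rewrite /galTrace mulr_sumr; apply: eq_bigr => s _; rewrite rmorphM /= gal_in_alg.
Qed.

(** The trace is invariant under [s], and [s] multiplies [y^k] by [z^k]. Hence
    [(z^k - 1) Tr (y^k) = 0], which kills the trace unless [l] divides [k]. *)
Lemma galTrace_root k : Tr (y ^+ k) = if (l %| k)%N then l%:R * y ^+ k else 0.
Proof.
have [s [sy Gs dL]] := kummer_generator_Fqt.
case: ifPn => [/dvdnP[j ->]|nlk].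
  rewrite mulnC exprM yl -rmorphXn /galTrace.
  under eq_bigr do rewrite gal_embedK.
  rewrite sumr_const mulr_natl; congr (_ *+ _).
  by rewrite -(galois_dim galL) dimv1 divn1.
have sG : s \in 'Gal({:L} / 1)%g by rewrite Gs cycle_id.
have := galTrace_gal (memvf (y ^+ k)) sG.
rewrite rmorphXn /= sy exprMn -rmorphXn galTrace_scale -/(e _) rmorphXn.
move/eqP; rewrite -subr_eq0 -{2}[Tr _]mul1r -mulrBl mulf_eq0 subr_eq0 exprz_eq1 (negPf nlk).
by move/eqP.
Qed.

(** Multiplication by [y^(l-i)] brings only the term of index [i] to an exponent divisible by [l],
    namely to [y^l = D]. *)
Lemma galTrace_coef (c : 'I_l -> Fqt F) (i : 'I_l) :
  Tr ((\sum_k (c k)%:A * y ^+ k) * y ^+ (l - i)) = l%:R * e D * (c i)%:A.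
Proof.
rewrite mulr_suml raddf_sum (bigD1 i) //= -mulrA galTrace_scale -exprD subnKC ?(ltnW (ltn_ord i)) //.
rewrite galTrace_root dvdnn yl mulrC big1 ?addr0 // => k ki.
rewrite -mulrA -exprD galTrace_scale galTrace_root ifN ?mulr0 //.
apply: contra ki => lki; rewrite -val_eqE /=.
have : (k + (l - i) = i + (l - i) %[mod l])%N.
  by rewrite (subnKC (ltnW (ltn_ord i))) modnn; apply/eqP.
by move/eqP; rewrite eqn_modDr !modn_small.
Qed.

Lemma root_span x : exists c : 'I_l -> Fqt F, x = \sum_k (c k)%:A * y ^+ k.
Proof.
have [_ [_ _ dL]] := kummer_generator_Fqt.
have xV : x \in <<1%AS; y>>%VS by rewrite yV memvf.
have al : adjoin_degree 1%AS y = l by rewrite -dL -[in RHS]yV dim_Fadjoin dimv1 muln1.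
have sP := size_Fadjoin_poly 1%AS y x; rewrite al in sP.
have /polyOverP oP := Fadjoin_polyOver 1%AS y x.
have /choice[c cP] (k : 'I_l) : exists c : Fqt F, (Fadjoin_poly 1%AS y x)`_k = c%:A.
  by have /vlineP[c] := oP k; exists c.
exists c; rewrite -{1}(Fadjoin_poly_eq xV) (horner_coef_wide _ sP).
by apply: eq_bigr => k _; rewrite cP.
Qed.

Lemma root_coef_inj (a b : 'I_l -> {poly F}) :
  \sum_k e (a k) * y ^+ k = \sum_k e (b k) * y ^+ k -> a =1 b.
Proof.
move=> ab i; apply: (@embedK_inj _ L).
have D0 : l%:R * e D != 0.
  rewrite mulf_neq0 ?embedK_eq0 //; last by apply: contraNneq (Dl 0) => ->; rewrite expr0n gtn_eqF.
  by rewrite -(rmorph_nat e) embedK_eq0 -(rmorph_nat polyC) polyC_eq0 natl_neq0.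
apply: (mulfI D0).
have := galTrace_coef (fun k => FracField.tofrac (a k)) i; rewrite /= ab => <-.
by rewrite (galTrace_coef (fun k => FracField.tofrac (b k))).
Qed.

(** By [galTrace_coef], [l D c_k] is the trace of an integral element, hence a polynomial; the
    factor [l] is then divided out, being nonzero in [F]. *)
Lemma intclos_coef x : O x ->
  exists b : 'I_l -> {poly F}, e D * x = \sum_k e (b k) * y ^+ k.
Proof.
move=> Ox; have [c xc] := root_span x.
have /choice[b bP] (k : 'I_l) : exists b, l%:R * e D * (c k)%:A = e b.
  have OT : O (Tr (x * y ^+ (l - k))).
    apply: intclos_sum => s _; apply/intclos_gal/intclosM => //.
    exact/intclosX/intclos_root.
  have /vlineP[t tE] := mem_galTrace galL (memvf (x * y ^+ (l - k))).
  rewrite -galTrace_coef -xc tE; apply: intclos_base; rewrite -tE; exact: OT.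
pose i := (l%:R : F)^-1; have il : e i%:P * l%:R = 1.
  rewrite -(rmorph_nat e) -rmorphM -(rmorph_nat polyC) -polyCM mulVf ?natl_neq0 //.
  by rewrite polyC1 rmorph1.
exists (fun k => i%:P * b k); rewrite xc mulr_sumr; apply: eq_bigr => k _.
by rewrite [e (_ * _)]rmorphM /= -bP !mulrA il mul1r.
Qed.

(** In the trace matrix of [1, y, ..., y^(l-1)] the entry at [(i, j)] vanishes unless [l] divides
    [i + j]. So it is a diagonal matrix times a permutation matrix, with determinant [l^l D^(l-1)]
    up to sign. *)
Lemma disc_gen_root : exists c : F, c != 0 /\ disc_gen L (c *: D ^+ l.-1).
Proof.
have [_ [_ _ dL]] := kummer_generator_Fqt.
suff [c c0 cE] : exists2 c : F, c != 0 &
    e (c *: D ^+ l.-1) = \det (\matrix_(i < \dim {:L}, j < \dim {:L}) Tr (y ^+ i * y ^+ j)).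
  exists c; split=> //; exists (fun i => y ^+ i); split=> // i.
  exact/intclosX/intclos_root.
(* The dimension is turned into a successor so that its ordinals form the group [Z/l]. *)
move: (\dim {:L}) dL => n En; have n0 : (0 < n)%N by rewrite En.
case: n En n0 => // n En _.
pose d : 'rV[L]_n.+1 := \row_i (if i == 0 then l%:R else l%:R * e D).
(* Negation in [Z/l] sends a row [i] to the one column [j] with [i + j] divisible by [l]. *)
pose s : 'S_n.+1 := perm (@oppr_inj 'I_n.+1).
have -> : (\matrix_(i < n.+1, j < n.+1) Tr (y ^+ i * y ^+ j)) = diag_mx d *m perm_mx s.
  rewrite mul_diag_mx; apply/matrixP => i j; rewrite !mxE permE -exprD galTrace_root.
  have E : (- i == j) = (l %| i + j)%N.
    by rewrite eq_sym -addr_eq0 -val_eqE /= addnC -En.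
  rewrite E; case: ifPn => [lij|]; rewrite ?mulr0 // mulr1.
  have [i0|i0] := eqVneq i 0.
    rewrite i0 add0n in lij *; move: lij; rewrite -En /dvdn modn_small // => /eqP ->.
    by rewrite expr0 mulr1.
  congr (_ * _); rewrite -yl; congr (_ ^+ _).
  have ipos : (0 < i)%N by rewrite lt0n -(inj_eq val_inj) in i0 *.
  (* A multiple of [l] strictly between [0] and [2 l] is [l] itself. *)
  have : (0 < i + j < l * 2)%N.
    rewrite addn_gt0 ipos /= muln2 -addnn -En -addSn leq_add // ?ltn_ord //.
    exact/ltnW/ltn_ord.
  case/dvdnP: lij => -[|[|m]] ->; rewrite ?mul0n ?mul1n // => /andP[_].
  by rewrite mulnC ltn_pmul2l.
rewrite det_mulmx det_diag det_perm big_ord_recl !mxE eqxx.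
rewrite (eq_bigr (fun=> l%:R * e D)) => [|i _]; last by rewrite mxE.
rewrite prodr_const card_ord exprMn.
exists ((-1) ^+ s * l%:R ^+ l); first by rewrite mulf_neq0 ?signr_eq0 ?expf_neq0 ?natl_neq0.
rewrite -mul_polyC rmorphM /= rmorphXn polyCM !rmorphM !rmorphXn /= rmorphN rmorph1.
by rewrite !rmorph_nat -En /= exprS rmorphN1 [RHS]mulrC !mulrA.
Qed.

Lemma kummer_disc_coprime g : coprimep D g -> disc_coprime L g.
Proof.
move=> cDg p ip pg H; have [c [c0 dgen]] := disc_gen_root.
have /H : disc_ideal L (c *: D ^+ l.-1).
  by exists 1, (fun=> c *: D ^+ l.-1), (fun=> 1); split=> //; rewrite big_ord1 mul1r.
rewrite dvdpZr // => /(irreducible_dvdpX ip) pD.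
case: ip => p1 _; have : p %| gcdp D g by rewrite dvdp_gcd pD.
by move/dvdp_leq; rewrite (eqP cDg) -size_poly_eq0 (eqP cDg) leqNgt p1 => /(_ isT).
Qed.

Lemma intclos_rep (b : 'I_l -> {poly F}) : O (\sum_k e (b k) * y ^+ k).
Proof.
by apply: intclos_sum => k _; apply: intclosM; [exact: intclos_embedK|exact/intclosX/intclos_root].
Qed.

(** Matrices in ['M[F]_(l, n)] encode the representatives [\sum_k r_k y^k] with [deg r_k < n]. Both
    injectivity and surjectivity pass through [D x], which lies in [F_q[t][y]], and use that [D] is
    invertible modulo [g]. *)
Lemma kummer_quot_card g : g != 0 -> coprimep D g ->
  quot_card O (e g) (#|F| ^ (l * (size g).-1)).
Proof.
move=> g0 cDg; set n := (size g).-1; have sg : size g = n.+1 by rewrite prednK ?size_poly_gt0.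
rewrite -(card_mx F l n).
apply: (@quot_card_reps _ _ _ _ (fun A : 'M[F]_(l, n) => \sum_k e (rVpoly (row k A)) * y ^+ k)).
- by move=> A; apply: intclos_rep.
- move=> A B [w [Ow E]]; have [c wc] := intclos_coef Ow.
  have E' : \sum_k e (D * (rVpoly (row k A) - rVpoly (row k B))) * y ^+ k =
            \sum_k e (g * c k) * y ^+ k.
    under eq_bigr do rewrite rmorphM rmorphB /= -mulrA mulrBl.
    under [RHS]eq_bigr do rewrite rmorphM /= -mulrA.
    by rewrite -!mulr_sumr sumrB E mulrCA wc.
  apply/row_matrixP => k; apply: (can_inj rVpolyK); apply/eqP; rewrite -subr_eq0.
  have gk : g %| rVpoly (row k A) - rVpoly (row k B).
    rewrite -(@Gauss_dvdpr _ _ D) ?(root_coef_inj E') ?dvdp_mulr //.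
    by rewrite coprimep_sym.
  apply: contraT => /dvdp_leq/(_ gk); rewrite sg -linearB.
  by rewrite ltnNge size_poly.
- move=> x Ox; have [b xb] := intclos_coef Ox.
  have /Bezout_eq1_coprimepP[[u v] /= uv] := cDg.
  (* With [u D + v g = 1] one has [x = g (v x) + u (D x)]; the coefficients [u b_k] of [u (D x)] are
     reduced modulo [g]. *)
  exists (\matrix_k poly_rV ((u * b k) %% g)).
  rewrite (eq_bigr (fun k => e ((u * b k) %% g) * y ^+ k)); last first.
    by move=> k _; rewrite rowK poly_rV_K // -ltnS -sg ltn_modp.
  exists (e v * x + \sum_k e ((u * b k) %/ g) * y ^+ k); split.
    apply: intclosD; last exact: intclos_rep.
    by apply: intclosM => //; apply: intclos_embedK.
  rewrite mulrDr mulr_sumr; apply/eqP; rewrite subr_eq -addrA -big_split /=.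
  rewrite (eq_bigr (fun k => e u * (e (b k) * y ^+ k))); last first.
    move=> k _; rewrite [e g * _]mulrA -mulrDl -rmorphM -rmorphD /= [g * _]mulrC -divp_eq.
    by rewrite rmorphM mulrA.
  rewrite -mulr_sumr -xb !mulrA -!rmorphM -mulrDl -rmorphD /= [g * v]mulrC addrC uv.
  by rewrite rmorph1 mul1r.
Qed.

(** * Frobenius modulo an irreducible polynomial prime to [D] *)

Section Frobenius.
Variables (p : {poly F}).
Hypothesis ip : monic_irreducible_poly p.
Let Q := (#|F| ^ (size p).-1)%N.
Hypotheses (lq : (l %| #|F|.-1)%N) (pD : ~~ (p %| D)) (Dz : p %| D ^+ (Q.-1 %/ l) - z%:P).

Let p0 : p != 0.
Proof. by case: ip => /irredp_neq0. Qed.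
Let Q0 : (0 < Q)%N.
Proof. by rewrite expn_gt0 (ltnW (card_finNzRing_gt1 F)). Qed.

Lemma root_frobenius : qcong O (e p) (y ^+ Q) (e z%:P * y).
Proof.
have lQ : (l %| Q.-1)%N := dvdn_predX _ lq.
have -> : y ^+ Q = e (D ^+ (Q.-1 %/ l)) * y.
  by rewrite rmorphXn /= -yl -exprM mulnC divnK // -exprSr prednK.
apply: qcongM; [exact: intclos_embedK|exact: intclos_root| |exact: qcong_refl].
exact/qcong_embedK.
Qed.

Section Generator.
Variable s : gal_of {:L}.
Hypothesis sy : s y = e z%:P * y.

(** The integral elements satisfying the congruence are closed under sums and products and contain
    [F_q[t]], [y] and all multiples of [p]. With [u p + v D = 1], every [x] is [p (u x) + v (D x)],
    and [D x] lies in [F_q[t][y]]. *)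
Lemma frobenius_gal x : O x -> qcong O (e p) (x ^+ Q) (s x).
Proof.
pose S w := O w /\ qcong O (e p) (w ^+ Q) (s w).
have SD w v : S w -> S v -> S (w + v).
  move=> [Ow Sw] [Ov Sv]; split; first exact: intclosD.
  (* Raising to the power [Q] is additive because [Q] is a power of the characteristic. *)
  rewrite exprDn_pchar ?rmorphD; first exact: qcongD.
  by rewrite pnatX (pchar_nat_card (e \o polyC)).
have SM w v : S w -> S v -> S (w * v).
  move=> [Ow Sw] [Ov Sv]; split; first exact: intclosM.
  by rewrite exprMn rmorphM; apply: qcongM => //; [exact: intclosX|exact: intclos_gal].
have Se a : S (e a).
  split; first exact: intclos_embedK.
  by rewrite gal_embedK -rmorphXn; apply/qcong_embedK/dvdp_frobenius.
have Sy : S y by split; [exact: intclos_root|rewrite sy; exact: root_frobenius].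
have Sp w : O w -> S (e p * w).
  move=> Ow; split; first by apply: intclosM => //; apply: intclos_embedK.
  apply: (qcong_trans (@intclosB _ _) (y := 0)).
    apply: (@qcong0 _ _ _ _ (e p ^+ Q.-1 * w ^+ Q)).
      by apply: intclosM; apply: intclosX => //; apply: intclos_embedK.
    by rewrite exprMn -{1}(prednK Q0) exprS mulrA.
  apply: (qcong_sym (@intclosB _ _)); apply: (@qcong0 _ _ _ _ (s w)); first exact: intclos_gal.
  by rewrite rmorphM /= gal_embedK.
move=> Ox; suff [] : S x by [].
have /Bezout_eq1_coprimepP[[u v] /= uv] : coprimep p D.
  by rewrite irreducible_poly_coprime //; case: ip.
have -> : x = e p * (e u * x) + e v * (e D * x).
  by rewrite !mulrA -!rmorphM -mulrDl -rmorphD mulrC [p * u]mulrC uv rmorph1 mulr1.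
have [b ->] := intclos_coef Ox.
apply: (SD); first by apply: Sp; apply: intclosM => //; apply: intclos_embedK.
have S1 : S 1 by rewrite -(rmorph1 e); apply: Se.
have S0 : S 0 by rewrite -(rmorph0 e); apply: Se.
apply: (SM _ _ (Se v)); apply: (big_ind S S0 SD) => k _; apply: (SM _ _ (Se _)).
by elim: (k : nat) => // j IHj; rewrite exprS; apply: (SM).
Qed.

Lemma frobenius_gal_exp x i : O x -> qcong O (e p) (x ^+ (Q ^ i)) ((s ^+ i)%g x).
Proof.
move=> Ox; elim: i => [|i IHi]; first by rewrite expg0 gal_id; apply: qcong_refl.
rewrite expnSr exprM expgSr galM ?memvf //.
have Osi := intclos_gal (s ^+ i)%g Ox.
apply: (qcong_trans (@intclosB _ _)) (frobenius_gal Osi).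
by apply: qcongX => //; apply: intclosX.
Qed.

End Generator.

Lemma kummer_inert : quot_is_field O (e p).
Proof.
have [s [sy Gs dL]] := kummer_generator_Fqt.
split=> [|x Ox nx].
  rewrite -(rmorph1 e) -(rmorph0 e) => /(qcong_embedK _ _ _ p0).
  rewrite subr0 dvdp1 => /eqP p1; have [[+ _] _] := ip.
  by rewrite p1.
have ON : O (galNorm 1%VS (fullv : {vspace L}) x).
  by apply: intclos_prod => f _; apply: intclos_gal.
have [a aN] : exists a, galNorm 1%VS (fullv : {vspace L}) x = e a.
  have /vlineP[t tE] := mem_galNorm galL (memvf x).
  have [|a ta] := @intclos_base _ L t; first by rewrite -tE; exact: ON.
  by exists a; rewrite -ta; exact: tE.
have [pa|npa] := boolP (p %| a); last first.
  have /Bezout_eq1_coprimepP[[u v] /= uv] : coprimep p a.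
    by rewrite irreducible_poly_coprime //; case: ip.
  (* When [p] does not divide the norm [a], the other conjugates of [x] multiply it to [a], and [v]
     inverts [a] modulo [p]. *)
  exists (e v * \prod_(f in 'Gal({:L} / 1)%g | f != 1%g) f x); split.
    apply: intclosM; first exact: intclos_embedK.
    by apply: intclos_prod => f _; apply: intclos_gal.
  move: aN; rewrite /galNorm (bigD1 1%g) ?group1 //= gal_id mulrCA => ->.
  rewrite -rmorphM -(rmorph1 e); apply/qcong_embedK => //.
  by rewrite -uv opprD addrCA subrr addr0 dvdpNr dvdp_mull.
(* Each conjugate [s^i x] is congruent to [x^(Q^i)], so the norm is congruent to a power [x^M]. *)
have [_ [M xM]] : O (galNorm 1%VS (fullv : {vspace L}) x) /\
    exists M, qcong O (e p) (galNorm 1%VS (fullv : {vspace L}) x) (x ^+ M).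
  apply: (big_ind (fun w => O w /\ exists M, qcong O (e p) w (x ^+ M))).
  - by split; [exact: intclos1|exists 0; exact: qcong_refl].
  - move=> w v [Ow [M wM]] [Ov [M' vM']]; split; first exact: intclosM.
    by exists (M + M')%N; rewrite exprD; apply: qcongM => //; apply: intclosX.
  - move=> f; rewrite Gs => /cycleP[i ->]; split; first exact: intclos_gal.
    exists (Q ^ i)%N; apply: (qcong_sym (@intclosB _ _)).
    exact: frobenius_gal_exp.
case: nx; have M0 : qcong O (e p) (x ^+ M) 0.
  apply: (qcong_trans (@intclosB _ _)) (qcong_sym (@intclosB _ _) xM) _.
  by rewrite aN -(rmorph0 e); apply/qcong_embedK; rewrite ?subr0.
(* The factor [l] makes the power of [s] trivial, so that [x] is congruent to [x^(Q^(l M))]. The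
   factor [M] ensures [M <= Q^(l M)], and [x^M] is already [0] modulo [p]. *)
have sl : (s ^+ (l * M) = 1)%g.
  have <- : #[s]%g = l by rewrite orderE -Gs -dL -(galois_dim galL) dimv1 divn1.
  by rewrite expgM expg_order expg1n.
have := frobenius_gal_exp sy (l * M) Ox; rewrite sl gal_id => /(qcong_sym (@intclosB _ _)) xx.
apply: (qcong_trans (@intclosB _ _) xx).
have Q1 : (1 < Q)%N.
  by rewrite -(expn0 #|F|) ltn_exp2l ?card_finNzRing_gt1 // -subn1 subn_gt0 ip.1.1.
have MQ : (M <= Q ^ (l * M))%N.
  by rewrite (leq_trans _ (ltnW (ltn_expl _ Q1))) // leq_pmull.
rewrite -(subnK MQ) exprD -(mulr0 (x ^+ (Q ^ (l * M) - M))).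
by apply: qcongM => //; [exact: intclosX|exact: intclos0|exact: qcong_refl].
Qed.

Lemma kummer_not_carmichael g : g != 0 -> coprimep D g -> p %| g ->
  (g %= p) \/ ~~ ((size p).-1 %| (size g).-1)%N -> ~ carmichael_in (e g).
Proof.
move=> g0 cDg pg [gp|nd] [N [cN nf xN]].
  case: nf; have [n1 inv] := kummer_inert; have gp' : g %| p by rewrite (eqp_dvdl _ gp).
  split=> [/(qcong_dvdp pg)//|x Ox nx].
  have [|w [Ow xw]] := inv x Ox; first by move/(qcong_dvdp gp').
  by exists w; split=> //; apply: qcong_dvdp xw.
(* This fixes the Carmichael exponent as [q^(l n)] with [n = deg g]. *)
have NE := quot_card_unique (@intclosB _ _) cN (kummer_quot_card g0 cDg).
move: xN; rewrite {N cN}NE => xN; case/negP: nd.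
(* Applied to polynomials, the Carmichael congruence gives [l n = m d] with [d = deg p]. Applied to
   [y], it then compares [y] with [s^m y = z^m y]. *)
have /(frobenius_order ip)/dvdnP[m lgm] a : p %| a ^+ (#|F| ^ (l * (size g).-1)) - a.
  apply/(@qcong_embedK _ L) => //; rewrite rmorphXn /=.
  by apply: qcong_dvdp pg _; apply/xN/intclos_embedK.
have [s [sy _ _]] := kummer_generator_Fqt.
have Oy := intclos_root.
have := xN y Oy; rewrite lgm mulnC expnM => /(qcong_dvdp pg)/(qcong_sym (@intclosB _ _)) yy.
have := qcong_trans (@intclosB _ _) yy (frobenius_gal_exp sy m Oy).
rewrite (@gal_exp_root _ (FracField.tofrac z%:P) L y s 1) ?expr1 // mul1n.
rewrite -[_%:A]/(e _) => yz.
have [/dvdnP[j mj]|nlm] := boolP (l %| m)%N.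
  apply/dvdnP; exists j; apply/eqP; rewrite -(eqn_pmul2l l0) lgm mj.
  by rewrite [(j * l)%N]mulnC mulnA.
(* Multiplying by [y^(l-1)] turns this into a congruence between [D] and [z^m D] in [F_q[t]], where
   [D] can be cancelled modulo [p]. *)
have yp : qcong O (e p) (e D) (e (z%:P ^+ m * D)).
  have -> : e D = y * y ^+ l.-1 by rewrite -exprS prednK.
  rewrite rmorphM rmorphXn /= -yl -{2}(prednK l0) exprS mulrA.
  apply: qcongM => //; [exact: intclosX|exact: qcong_refl].
move/(qcong_embedK _ _ _ p0): yp; rewrite -{1}[D]mul1r -mulrBl -rmorphXn -polyC1 -polyCB mul_polyC.
rewrite dvdpZr ?(negPf pD) // subr_eq0 eq_sym -(prim_order_dvd pz).
by rewrite (negPf nlm).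
Qed.

End Frobenius.

End KummerFunctionField.

(** * Non-isomorphic Kummer extensions *)

Lemma power_Fqt (F : finFieldType) l (D : {poly F}) (u : Fqt F) : (0 < l)%N ->
  u ^+ l = FracField.tofrac D -> exists a : {poly F}, a ^+ l = D.
Proof.
move=> l0 /eqP uD; apply: contrapT => H.
have /(no_power_Fqt l0)/(_ u) : forall a : {poly F}, a ^+ l != D.
  by move=> a; apply/eqP => aD; case: H; exists a.
by rewrite uD.
Qed.

Lemma ext_iso_sym (F : finFieldType) (L1 L2 : splittingFieldType (Fqt F)) :
  ext_iso L1 L2 -> ext_iso L2 L1.
Proof.
case=> f [fD fM f1 fc [h fK hK]]; exists h; split; last by exists f.
- by move=> x y; apply: (can_inj fK); rewrite fD !hK.
- by move=> x y; apply: (can_inj fK); rewrite fM !hK.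
- by rewrite -f1 fK.
- by move=> c; rewrite -fc fK.
Qed.

Lemma kummer_not_iso (F : finFieldType) l (z : F) (D1 D2 r : {poly F})
    (L1 L2 : splittingFieldType (Fqt F)) (y1 : L1) (y2 : L2) :
  prime l -> l.-primitive_root z -> y1 ^+ l = embedK L1 D1 ->
  y2 ^+ l = embedK L2 D2 -> <<1; y2>>%VS = fullv -> (forall a, a ^+ l != D2) ->
  irreducible_poly r -> r %| D1 -> ~~ (r ^+ 2 %| D1) -> ~~ (r %| D2) ->
  ~ ext_iso L1 L2.
Proof.
move=> pl pz y1l y2l y2V D2l ir rD1 nrD1 nrD2 [f [fD fM f1 fc _]].
have l0 := prime_gt0 pl.
have D2k := no_power_Fqt l0 D2l.
have pzk := primitive_root_Fqt pz.
have xl : f y1 ^+ l = (FracField.tofrac D1)%:A.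
  have fX n x : f (x ^+ n) = f x ^+ n.
    by elim: n => [|n IHn]; rewrite ?expr0 // !exprS fM IHn.
  by rewrite -fX y1l fc.
set x := f y1 in xl.
have x0 : x != 0.
  apply: contraNneq nrD1 => x0; move: xl; rewrite x0 expr0n gtn_eqF // => /esym/eqP.
  by rewrite -/(embedK L2 D1) embedK_eq0 => /eqP ->; rewrite dvdp0.
have y20 := kummer_gen_neq0 pl y2l D2k.
have [s [sy Gs _]] := kummer_generator pl pzk y2l y2V D2k.
have [i sx] := gal_root_scale pzk s x0 xl.
(* Both [x] and [y2^i] are multiplied by [z^i] under [s], so their quotient lies in the base
   field. *)
have sw : s (x / y2 ^+ i) = x / y2 ^+ i.
  rewrite fmorph_div rmorphXn /= sx sy exprMn -mulf_div divff ?mul1r //.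
  rewrite expf_neq0 // -[_%:A]/(embedK L2 _) embedK_eq0 polyC_eq0.
  apply: contra_eqN (prim_expr_order pz) => /eqP ->.
  by rewrite expr0n gtn_eqF // eq_sym oner_eq0.
have [|c wc] := @mem_baseP _ _ _ _ _ _ pl pzk y2l y2V D2k (x / y2 ^+ i).
  move=> _ /[!Gs]/cycleP[n ->]; elim: n => [|n IHn]; first by rewrite expg0 gal_id.
  by rewrite expgSr galM ?memvf // IHn.
have xE : x = c%:A * y2 ^+ i by rewrite -wc mulfVK // expf_neq0.
have D1E : FracField.tofrac D1 = c ^+ l * FracField.tofrac D2 ^+ i.
  apply: (fmorph_inj (in_alg L2)); rewrite rmorphM !rmorphXn /= -xl xE exprMn.
  by rewrite exprAC y2l.
(* From [D1 = c^l D2^i], this product is the [l]-th power of [c D2^i], which is therefore a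
   polynomial although [c] may be a fraction. *)
have [a aE] : exists a, a ^+ l = D1 * (D2 ^+ i) ^+ l.-1.
  apply: (@power_Fqt _ _ _ (c * FracField.tofrac D2 ^+ i)) => //.
  by rewrite tofracM !tofracXn D1E exprMn -mulrA -exprS prednK.
have ra : r %| a.
  by apply: (@irreducible_dvdpX _ _ _ l) => //; rewrite aE dvdp_mulr.
case/negP: nrD1; rewrite -(@Gauss_dvdpl _ _ ((D2 ^+ i) ^+ l.-1)).
  by rewrite -aE; apply: dvdp_trans (dvdp_exp2l _ (prime_gt1 pl)); apply: dvdp_exp2r.
by rewrite coprimep_expl // !coprimep_expr // irreducible_poly_coprime.
Qed.

(** * Construction of the radicands *)

Lemma exists_primitive_root (F : finFieldType) l : (l %| #|F|.-1)%N ->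
  exists z : F, l.-primitive_root z.
Proof.
move=> lq; have q0 : (0 < #|F|.-1)%N by rewrite -subn1 subn_gt0 card_finNzRing_gt1.
have : has (#|F|.-1).-primitive_root (enum (predC1 (0 : F))).
  apply: has_prim_root => //; rewrite ?enum_uniq // -?cardE ?cardC1 //.
  apply/allP => x; rewrite mem_enum inE => x0; apply/unity_rootP.
  by apply: (mulfI x0); rewrite -exprS prednK ?expf_card ?mulr1 // (ltnW (card_finNzRing_gt1 F)).
by case/hasP=> z _ pz; exists (z ^+ (#|F|.-1 %/ l)); exact: (dvdn_prim_root pz lq).
Qed.

Lemma exists_kummer_radicand (F : finFieldType) (g p h : {poly F}) l :
  squarefree_poly g -> g != 0 -> h != 0 -> monic_irreducible_poly p -> p %| g ->
  prime l -> (l %| #|F|.-1)%N ->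
  exists D z r, [/\ l.-primitive_root z, coprimep D g,
    p %| D ^+ ((#|F| ^ (size p).-1).-1 %/ l) - z%:P, irreducible_poly r &
    [/\ r %| D, ~~ (r ^+ 2 %| D) & ~~ (r %| h)]].
Proof.
move=> sqg g0 h0 ip pg pl lq; set m := (_ %/ l)%N.
have [z0 pz0] := exists_primitive_root lq.
(* As in Euclid's argument, an irreducible factor of [g h X + 1] divides neither [g] nor [h]. *)
have [|r [ir _ rgh]] := @irreducible_factor F (g * h * 'X + 1).
  by rewrite -polyC1 size_MXaddC mulf_eq0 (negPf g0) (negPf h0) /= ltnS size_poly_gt0 mulf_neq0.
have r1 : ~~ (r %| 1) by rewrite dvdp1; apply: contraTneq ir.1 => ->.
have nrgh : ~~ (r %| g * h).
  by apply: contra r1 => rgh'; rewrite -(dvdp_addr 1 (dvdp_mulr 'X rgh')).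
have nrg : ~~ (r %| g) by apply: contra nrgh; apply: dvdp_mulr.
have nrh : ~~ (r %| h) by apply: contra nrgh; apply: dvdp_mull.
have [g' gE] : exists g', g = g' * p by apply/dvdpP.
have cpg' : coprimep p g'.
  rewrite irreducible_poly_coprime; last by case: ip.
  apply: contra (sqg p ip.1.1) => pg'; by rewrite gE dvdp_mul.
have [c0 /andP[pc0 pc0m]] := exists_power_nonresidue ip pl lq.
(* Two congruence systems determine [D]: it is [c0] modulo [p], [1] modulo [g / p], and [r] modulo
   [r^2]. The last makes [r] divide [D] exactly once. *)
have [c [pc g'c]] := polynomial_crt c0 1 cpg'.
have crg : coprimep g (r ^+ 2).
  by rewrite coprimep_sym coprimep_expl // irreducible_poly_coprime.
have [D [gD rD]] := polynomial_crt c r crg.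
have pDc0 : p %| D - c0.
  by rewrite -(subrK c D) -addrA dvdp_add //; apply: dvdp_trans gD.
have npD : ~~ (p %| D) by rewrite -(subrK c0 D) dvdp_addr.
have g'D : g' %| D - 1.
  rewrite -(subrK c D) -addrA dvdp_add //; apply: dvdp_trans gD.
  by rewrite gE dvdp_mulr.
have [i Dz] := power_residue_symbol ip pz0 lq npD.
(* Otherwise [c0^m] would be [1] modulo [p]. As [l] is prime, [z0^i] is then again a primitive
   root. *)
have ncz : ~~ (l %| i)%N.
  apply: contra pc0m; rewrite (prim_order_dvd pz0) => /eqP zi1.
  have pcD : p %| c0 ^+ m - D ^+ m.
    by rewrite subrXX dvdp_mulr // -dvdpNr opprB.
  by rewrite -(subrK (D ^+ m) (c0 ^+ m)) -addrA dvdp_add // -polyC1 -zi1.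
exists D, (z0 ^+ i), r; split=> //.
- by rewrite prim_root_exp_coprime // coprime_sym prime_coprime.
- have cDp : coprimep D p by rewrite coprimep_sym irreducible_poly_coprime //; case: ip.
  rewrite gE coprimepMr cDp andbT.
  apply/Bezout_eq1_coprimepP; case/dvdpP: g'D => w wE; exists (1, - w) => /=.
  by rewrite mul1r mulNr -wE subKr.
- split=> //.
  + rewrite -(subrK r D) dvdp_add //; apply: dvdp_trans rD.
    by rewrite exprS dvdp_mulr.
  + rewrite -(subrK r D) dvdp_addr //; apply/negP => /dvdp_leq.
    have r0 := irredp_neq0 ir; rewrite r0 => /(_ isT).
    rewrite expr2 size_mul // leqNgt; case/negP.
    by case: (size r) ir.1 => [|[|k]] // _; rewrite addnS -[ltnLHS]addn0 ltn_add2l.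
Qed.

(** * The distinguished factor of [g] and the infinite family *)

Lemma not_carmichael_factor (F : finFieldType) (g : {poly F}) : (1 < size g)%N ->
  squarefree_poly g -> ~ carmichael_poly g ->
  exists p, [/\ monic_irreducible_poly p, p %| g &
    (g %= p) \/ ~~ ((size p).-1 %| (size g).-1)%N].
Proof.
move=> g1 sqg ncg; apply: contrapT => H; apply: ncg.
have g0 : g != 0 by rewrite -size_poly_gt0 ltnW.
have sg : size g = (size g).-1.+1 by rewrite prednK // ltnW.
exists (#|F| ^ (size g).-1)%N; split.
- rewrite -[X in (_ ^ X)%N]mul1n -(card_mx F 1 (size g).-1).
  apply: (@quot_card_reps _ _ _ _ (fun A : 'rV[F]_(size g).-1 => rVpoly A)) => //.
  + move=> A B [w [_ E]]; apply: (can_inj rVpolyK); apply/eqP; rewrite -subr_eq0.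
    have gAB : g %| rVpoly A - rVpoly B by rewrite E dvdp_mulr.
    apply: contraT => /dvdp_leq/(_ gAB); rewrite -linearB.
    by rewrite [leqLHS]sg ltnNge size_poly.
  + move=> x _; exists (poly_rV (x %% g)); rewrite poly_rV_K; last by rewrite -ltnS -sg ltn_modp.
    by exists (x %/ g); split=> //; rewrite {1}(divp_eq x g) addrK mulrC.
(* By the contrary assumption [g] is not associated to [p], so [p] is nonzero modulo [g]; an inverse
   of it would make [p] divide [1]. *)
- have [p [ip mp pg]] := irreducible_factor g1; case=> _ inv.
  have [|w [_ [v [_ E]]]] := inv p I.
    case=> v [_ E]; apply: H; exists p; split=> //; left.
    by rewrite /eqp pg andbT -[p]subr0 E dvdp_mulr.
  have : p %| 1.
    have -> : 1 = p * w - g * v by rewrite -E subKr.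
    by rewrite dvdp_sub ?dvdp_mulr.
  by rewrite dvdp1 => /eqP p1; case: ip; rewrite p1.
- move=> x _; suff /dvdpP[w E] : g %| x ^+ (#|F| ^ (size g).-1) - x.
    by exists w; split=> //; rewrite E mulrC.
  apply: squarefree_dvdp => // p' ip' p'g.
  (* Passing to a monic associate makes the residue field, and so [dvdp_frobenius_exp],
     available. *)
  have [p [ip mp pp']] := irreducible_factor ip'.1.
  have /eqp_dvdl <- : p %= p' by apply: (apply_irredp ip') => //; rewrite gtn_eqF // ip.1.
  apply: dvdp_frobenius_exp => //; apply: contraT => nd; case: H.
  by exists p; split=> //; [exact: dvdp_trans p'g|right].
Qed.

Theorem theorem5p6 (F : finFieldType) (g : {poly F}) (l : nat) :
  (3 <= #|F|)%N ->
  (1 < size g)%N ->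
  squarefree_poly g ->
  ~ carmichael_poly g ->
  prime l -> (l %| #|F|.-1)%N ->
  exists Ks : nat -> splittingFieldType (Fqt F),
    (forall n, [/\ cyclic_ext (Ks n) l, disc_coprime (Ks n) g
                 & ~ carmichael_in (embedK (Ks n) g)]) /\
    (forall n m, n <> m -> ~ ext_iso (Ks n) (Ks m)).
Proof.
move=> _ g1 sqg ncg pl lq; have g0 : g != 0 by rewrite -size_poly_gt0 ltnW.
have [p [ip pg pdeg]] := not_carmichael_factor g1 sqg ncg.
pose good h D := exists z r, [/\ l.-primitive_root z, coprimep D g,
    p %| D ^+ ((#|F| ^ (size p).-1).-1 %/ l) - z%:P, irreducible_poly r &
    [/\ r %| D, ~~ (r ^+ 2 %| D) & ~~ (r %| h)]].
(* Choice requires a value for every [h]; at [h = 0] the value [0] is a placeholder. *)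
have /choice[rad radP] h : exists D, h != 0 -> good h D.
  have [->|h0] := eqVneq h 0; first by exists 0.
  by have [D ?] := exists_kummer_radicand sqg g0 h0 ip pg pl lq; exists D.
(* The product of the radicands chosen so far, so that the prime [r] of the next radicand divides
   none of them. *)
pose H := fix H n := if n is m.+1 then H m * rad (H m) else 1.
have H0 n : H n != 0.
  elim: n => [|n IHn] /=; first exact: oner_neq0.
  rewrite mulf_neq0 //; have [z [r [_ _ _ _ [_ + _]]]] := radP _ IHn.
  by apply: contraNneq => ->; rewrite dvdp0.
pose D n := rad (H n).
have Dl n a : a ^+ l != D n.
  have [z [r [_ _ _ ir [rD rD2 _]]]] := radP _ (H0 n).
  apply: contraNneq rD2 => aD; rewrite -/(D n) -aD.
  have ra : r %| a by apply: (@irreducible_dvdpX _ _ _ l) => //; rewrite aD.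
  by apply: dvdp_trans (dvdp_exp2l _ (prime_gt1 pl)); apply: dvdp_exp2r.
have DH m n : (m < n)%N -> D m %| H n.
  elim: n => // n IHn; rewrite ltnS leq_eqVlt => /predU1P[->|/IHn mn] /=.
    exact: dvdp_mull.
  exact: dvdp_mulr.
have /choice[Ks KsP] n : exists L : splittingFieldType (Fqt F), exists y : L,
    y ^+ l = embedK L (D n) /\ <<1; y>>%VS = fullv.
  have [z [r [pz _ _ _ _]]] := radP _ (H0 n).
  apply: (exists_kummer_extension (primitive_root_Fqt pz)).
  by rewrite tofrac_eq0; apply: contraNneq (Dl n 0) => ->; rewrite expr0n gtn_eqF ?prime_gt0.
exists Ks; split=> [n|].
  have [y [yl yV]] := KsP n.
  have [z [r [pz cDg Dz _ _]]] := radP _ (H0 n).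
  have [s [_ Gs dL]] := kummer_generator_Fqt pl pz yl yV (Dl n).
  have pzk := primitive_root_Fqt pz.
  have npD : ~~ (p %| D n).
    rewrite -irreducible_poly_coprime; last by case: ip.
    by rewrite coprimep_sym; exact: (coprimep_dvdl pg cDg).
  split; first split=> //.
  - exact: kummer_galois pl pzk yl yV (no_power_Fqt (prime_gt0 pl) (Dl n)).
  - by rewrite Gs cycle_cyclic.
  - exact: kummer_disc_coprime pl pz yl yV (Dl n) _ cDg.
  - exact: (kummer_not_carmichael pl pz yl yV (Dl n) ip).
(* The prime [r] attached to the larger index [n] divides [D n] once and does not divide [D m],
   which is a factor of [H n]. The opposite order of indices follows by symmetry of [ext_iso]. *)
have niso m n : (m < n)%N -> ~ ext_iso (Ks n) (Ks m).
  move=> mn; have [y [yl yV]] := KsP m; have [y' [y'l _]] := KsP n.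
  have [z [r [pz _ _ ir [rD rD2 rH]]]] := radP _ (H0 n).
  apply: (kummer_not_iso pl pz y'l yl yV (Dl m) ir rD rD2).
  by apply: contra rH => /dvdp_trans; apply; apply: DH.
move=> n m nm; have [mn|nm'|mn] := ltngtP m n; [exact: niso| |by case: nm].
by move/ext_iso_sym; apply: niso.
Qed.
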